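(* Assume the uniform PL$^\circ$ condition, the curvature bound and the regularity conditions, and let the common dimension satisfy $\mathtt k\ge1$. Let $K_0<\infty$ and $\lambda_0>0$ be constants independent of $\theta$ with $\mathbb W_1(\mu_\theta^\lambda,\mu_\theta^0)\le K_0\sqrt\lambda$ for all $\theta\in\Theta$, $0<\lambda\le\lambda_0$, and let $\mathsf C_0,r_0,\kappa,\mathsf c_L,c_1$ be the $\theta$-independent geometric constants described in the context. Then for every $\theta\in\Theta$, every $\delta\in(0,1)$ with $$\delta<\mathsf c_L C_{\mathtt k}\kappa\left(\tfrac14\min\{c_1/\sqrt{2\mathsf C_0},\,r_0\}\right)^{\mathtt k},\qquad C_{\mathtt k}:=\frac{\pi^{\mathtt k/2}}{\Gamma(\mathtt k/2+1)},$$ and every $0<\lambda\le\lambda_0$, $$\left|F_{\max}(\theta)-\tilde F_{\mathrm{SQG}}(\theta)\right|\le\frac{4L_{f,1}\,\delta^{1/\mathtt k}}{(\kappa\,\mathsf c_L C_{\mathtt k})^{1/\mathtt k}}+\frac{L_{f,1}}{\delta}K_0\lambda^{1/2}.$$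
   Context: Setting: $m\ge1$, $d\ge2$; $\Theta\subset\mathbb R^m$ is a nonempty compact convex set; $f,g:\Theta\times\mathbb R^d\to\mathbb R$; $\|\cdot\|$ is the Euclidean norm (or induced operator norm); $\partial_\theta,\partial_x$ are the gradients in the first/second argument and $\partial_x^2$ is the Hessian in $x$. $\mathcal S(\theta):=\operatorname{argmin}_{x\in\mathbb R^d}g(\theta,x)$ and $F_{\max}(\theta):=\max_{x\in\mathcal S(\theta)}f(\theta,x)$. PL$^\circ$: a $\mathcal C^1$ function $h:\mathbb R^d\to\mathbb R$ with set of local minima $\mathcal M$ is locally PL with constant $\mu>0$ if every connected component $\mathcal M'$ of $\mathcal M$ has an open neighborhood $\mathcal N(\mathcal M')\supset\mathcal M'$ with $h(x)-\min_{x'\in\mathcal N(\mathcal M')}h(x')\le(2\mu)^{-1}\|\nabla h(x)\|^2$ for all $x\in\mathcal N(\mathcal M')$. $h$ satisfies the PL$^\circ$ condition with constant $\mu$ if (a) $h\in\mathcal C^2$, $h$ is locally PL with constant $\mu$, and $h$ is $\mathcal C^4$ on every $\mathcal N(\mathcal M')$; (b) every $x\notin\bigcup_{\mathcal M'}\mathcal N(\mathcal M')$ with $\nabla h(x)=0$ satisfies $\nabla^2h(x)\prec0$; (c) $\mathcal M$ is contained in a compact set. Uniform PL$^\circ$ condition: there is one $\mu>0$ such that for every $\theta\in\Theta$, $g(\theta,\cdot)$ satisfies the PL$^\circ$ condition with constant $\mu$ (the neighborhoods may depend on $\theta$). Regularity conditions (constants independent of $\theta$): (i) $f$ is $\mathcal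 C^1$ and $L_{f,1}$-Lipschitz with respect to $(\theta,x)$, and $|f(\theta,x)|\le C_f\|x\|^{\mathsf n_f}+D_f$ for all $x$, with $C_f,D_f\ge0$ and an integer $\mathsf n_f\ge1$. (ii) $g$ has a $\mathcal C^2$ extension to an open neighborhood of $\Theta\times\mathbb R^d$; $\|\partial_xg(\theta,x)-\partial_xg(\theta,x')\|\le L_{g,xx}\|x-x'\|$ and $\|\partial_xg(\theta,x)-\partial_xg(\theta',x)\|\le L_{g,\theta x}\|\theta-\theta'\|$ for all $\theta,\theta'\in\Theta$, $x,x'\in\mathbb R^d$; and $\|\partial_\theta g(\theta,x)\|\le C_g\|x\|^{\mathsf n_g}+D_g$ with $C_g,D_g\ge0$, integer $\mathsf n_g\ge1$. (iii) $\partial_x^2g$ is continuous in $(\theta,x)$. (iv) There are $r_3>0$, $L_{g,3}<\infty$ with $\|\partial_x^2g(\theta,x)-\partial_x^2g(\theta,y)\|\le L_{g,3}\|x-y\|$ for all $\theta\in\Theta$ and all $x,y$ with $\max\{\operatorname{dist}(x,\mathcal S(\theta)),\operatorname{dist}(y,\mathcal S(\theta))\}\le r_3$. (v) There are $\mathsf D_{\mathsf{eb}},\nu_{\mathsf{eb}}>0$ with $\|\partial_xg(\theta,x)\|\ge\nu_{\mathsf{eb}}\operatorname{dist}(x,\mathcal S(\theta))$ for all $\theta\in\Theta$, $\|x\|\ge\mathsf D_{\mathsf{eb}}$. Known facts: under these conditions each $\mathcal S(\theta)$ is a nonempty compact connected $\mathcal C^2$ embedded submanifold of $\mathbb R^d$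 without boundary, and all $\mathcal S(\theta)$ have a common dimension $\mathtt k$. $\mathcal S(\theta)$ carries the Euclidean-induced Riemannian metric $\mathsf g_\theta$, with geodesic distance and Riemannian volume measure $\mathcal M_\theta$; $\mathbb B_{\mathsf g_\theta}(p;r)$ is the open geodesic ball. Curvature bound: there is $\mathsf C>0$, independent of $\theta$, with $\sup_{u\in T_x\mathcal S(\theta),\|u\|=1}\|\mathrm{II}(x)[u,u]\|\le\mathsf C$ for all $\theta\in\Theta$, $x\in\mathcal S(\theta)$, where the second fundamental form $\mathrm{II}(x)[u,v]$ is the component normal to $T_x\mathcal S(\theta)$ of the derivative in direction $u$ of a local $\mathcal C^1$ tangent extension of $v$. Measures: for $\lambda>0$, $\mu_\theta^\lambda(dx)\propto e^{-g(\theta,x)/\lambda}dx$ (Gibbs measure). The limiting measure is $\mu_\theta^0(da)=\rho_\theta(a)\,d\mathcal M_\theta(a)$ on $\mathcal S(\theta)$, $\rho_\theta=w_\theta/\int_{\mathcal S(\theta)}w_\theta\,d\mathcal M_\theta$, where $w_\theta(a)=\det(H_\theta^\perp(a))^{-1/2}$ and $H_\theta^\perp(a)$ is the (positive definite) Hessian $\partial_x^2g(\theta,a)$ compressed to the normal space $N_a\mathcal S(\theta)$. $\mathbb W_1$ is the 1-Wasserstein distance. Superquantile–Gibbs loss: for $\lambda>0$, $\delta\in(0,1)$, $\tilde F_{\mathrm{SQG}}(\theta):=\min_{\beta\in\mathbb R}\phi_{\lambda,\delta}(\theta,\beta)$ with $\phi_{\lambda,\delta}(\theta,\beta):=\beta+\frac1\delta\mathbb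 E_{X\sim\mu_\theta^\lambda}[\max\{f(\theta,X)-\beta,0\}]$. Geometric constants (all independent of $\theta$; they exist under the stated conditions): $\mathsf C_0>0$ bounds the absolute value of all sectional curvatures of all $\mathcal S(\theta)$; $r_0>0$ is a lower bound for the injectivity radius of all $\mathcal S(\theta)$ at all points; $\kappa>0$ satisfies $\kappa\le\rho_\theta\le1/\kappa$ on $\mathcal S(\theta)$ for all $\theta$; and $\mathsf c_L,c_1>0$ satisfy $\mathcal M_\theta(\mathbb B_{\mathsf g_\theta}(p;r))\ge\mathsf c_L C_{\mathtt k}r^{\mathtt k}$ for all $\theta\in\Theta$, $p\in\mathcal S(\theta)$, $0<r<\min\{r_0,c_1/\sqrt{2\mathsf C_0}\}$. *)

(* Defs.v *)
From HB Require Import structures.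
From mathcomp Require Import all_boot all_order all_algebra.
From mathcomp Require Import all_classical all_reals all_analysis.
Import numFieldNormedType.Exports.
Import Order.TTheory GRing.Theory Num.Theory.

Set Implicit Arguments.
Unset Strict Implicit.
Unset Printing Implicit Defensive.

Local Open Scope classical_set_scope.
Local Open Scope ring_scope.

Section Generic.
Context {disp : Order.disp_t} {T : porderType disp}.
Implicit Types (A : set T) (a : T).

Definition is_min A a := A a /\ lbound A a.

Definition is_max A a := A a /\ ubound A a.

End Generic.

Section Euclidean.
Context {R : realType}.

(* The library norm on row vectors is the sup norm: it induces the right
   topology but not the Euclidean length, hence [enorm]. *)
Definition inner n (x y : 'rV[R]_n) : R := \sum_i x 0 i * y 0 i.

Definition enorm n (x : 'rV[R]_n) : R := Num.sqrt (inner x x).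

Definition opnorm n p (A : 'M[R]_(n, p)) : R :=
  sup [set enorm (x *m A) | x in [set x : 'rV[R]_n | enorm x <= 1]].

Definition edist n (x : 'rV[R]_n) (A : set 'rV[R]_n) : \bar R :=
  ereal_inf [set (enorm (x - y))%:E | y in A].

Definition eball n (r : R) : set 'rV[R]_n := [set x | enorm x < r].

Definition negative_definite n (A : 'M[R]_n) :=
  forall v : 'rV[R]_n, v != 0 -> inner (v *m A) v < 0.

End Euclidean.

Section Differential.
Context {R : realType}.

Definition partial n (i : 'I_n) (f : 'rV[R]_n -> R) : 'rV[R]_n -> R :=
  fun x => 'D_(delta_mx 0 i) f x.

Definition grad n (f : 'rV[R]_n -> R) (x : 'rV[R]_n) : 'rV[R]_n :=
  \row_i partial i f x.

Definition hess n (f : 'rV[R]_n -> R) (x : 'rV[R]_n) : 'M[R]_n :=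
  \matrix_(i, j) partial j (partial i f) x.

(* class C^r on the open set U *)
Fixpoint Ck n (r : nat) (U : set 'rV[R]_n) (f : 'rV[R]_n -> R) : Prop :=
  if r is r'.+1 then
    (forall x, U x -> differentiable f x) /\
    (forall i, Ck r' U (partial i f))
  else forall x, U x -> {for x, continuous f}.

Definition Ckv n p (r : nat) (U : set 'rV[R]_n) (phi : 'rV[R]_n -> 'rV[R]_p) :=
  forall j, Ck r U (fun u => phi u 0 j).

(* G is a C^r extension, to the open neighborhood U of Theta x R^d, of the
   function g of two vector arguments. *)
Definition Ck_extension m d (r : nat) (Theta : set 'rV[R]_m)
    (g : 'rV[R]_m -> 'rV[R]_d -> R)
    (U : set 'rV[R]_(m + d)) (G : 'rV[R]_(m + d) -> R) :=
  [/\ open U,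
      forall theta x, Theta theta -> U (row_mx theta x),
      Ck r U G &
      forall theta x, Theta theta -> G (row_mx theta x) = g theta x].

End Differential.

Section PL.
Context {R : realType} {d : nat}.
Implicit Types (h : 'rV[R]_d -> R) (N : set 'rV[R]_d -> set 'rV[R]_d).

Definition argmin h : set 'rV[R]_d := [set x | forall y, h x <= h y].

Definition locmin h : set 'rV[R]_d := [set x | \forall y \near x, h x <= h y].

Definition components (A : set 'rV[R]_d) : set (set 'rV[R]_d) :=
  [set connected_component A x | x in A].

(* h is locally PL with constant mu, with neighborhoods N *)
Definition locally_PL (mu : R) h N :=
  forall M', components (locmin h) M' ->
    [/\ open (N M'),
        M' `<=` N M' &
        exists hmin, is_min (h @` N M') hmin /\
          forall x, N M' x ->
            h x - hmin <= (2 * mu)^-1 * enorm (grad h x) ^+ 2].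

Definition PLcirc (mu : R) h :=
  0 < mu /\ exists N,
  [/\ [/\ Ck 2 setT h,
          locally_PL mu h N &
          forall M', components (locmin h) M' -> Ck 4 (N M') h],
      forall x, ~ (exists2 M', components (locmin h) M' & N M' x) ->
        grad h x = 0 -> negative_definite (hess h x) &
      exists2 K, compact K & locmin h `<=` K].

End PL.

Section Conditions.
Context {R : realType} {m d : nat}.
Variables (Theta : set 'rV[R]_m).

Definition solset (g : 'rV[R]_m -> 'rV[R]_d -> R) (theta : 'rV[R]_m) :
  set 'rV[R]_d := argmin (g theta).

Definition uniform_PLcirc (g : 'rV[R]_m -> 'rV[R]_d -> R) :=
  exists2 mu : R, 0 < mu & forall theta, Theta theta -> PLcirc mu (g theta).

(* Since Theta may have empty interior, "f is C^1" is read as the existence of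
   a C^1 extension to an open neighborhood of Theta x R^d. *)
Definition upper_regular (f : 'rV[R]_m -> 'rV[R]_d -> R) (Lf1 : R) :=
  [/\ exists U F, Ck_extension 1 Theta f U F,
      forall theta theta' x x', Theta theta -> Theta theta' ->
        `|f theta x - f theta' x'| <=
          Lf1 * enorm (row_mx theta x - row_mx theta' x') &
      exists (Cf Df : R) (nf : nat), [/\ 0 <= Cf, 0 <= Df, (1 <= nf)%N &
        forall theta x, Theta theta ->
          `|f theta x| <= Cf * enorm x ^+ nf + Df]].

Definition lower_regular (g : 'rV[R]_m -> 'rV[R]_d -> R) :=
  [/\ exists U G, Ck_extension 2 Theta g U G /\
        exists (Cg Dg : R) (ng : nat), [/\ 0 <= Cg, 0 <= Dg, (1 <= ng)%N &
          forall theta x, Theta theta ->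
            enorm (grad (fun t => G (row_mx t x)) theta) <=
              Cg * enorm x ^+ ng + Dg],
      exists Lgxx Lgtx : R,
        (forall theta x x', Theta theta ->
          enorm (grad (g theta) x - grad (g theta) x') <=
            Lgxx * enorm (x - x')) /\
        (forall theta theta' x, Theta theta -> Theta theta' ->
          enorm (grad (g theta) x - grad (g theta') x) <=
            Lgtx * enorm (theta - theta')),
      {within Theta `*` [set: 'rV[R]_d],
        continuous (fun z : 'rV[R]_m * 'rV[R]_d => hess (g z.1) z.2)},
      exists r3 Lg3 : R, 0 < r3 /\
        forall theta x y, Theta theta ->
          (edist x (solset g theta) <= r3%:E)%E ->
          (edist y (solset g theta) <= r3%:E)%E ->
          opnorm (hess (g theta) x - hess (g theta) y) <= Lg3 * enorm (x - y) &
      exists Deb nueb : R, [/\ 0 < Deb, 0 < nueb &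
        forall theta x, Theta theta -> Deb <= enorm x ->
          (nueb%:E * edist x (solset g theta) <=
             (enorm (grad (g theta) x))%:E)%E]].

End Conditions.

Section Submanifold.
Context {R : realType} {d : nat}.
Implicit Types (S : set 'rV[R]_d) (p v : 'rV[R]_d).

(* phi, restricted to U, is a C^r local parametrization of S: an immersion
   which is a homeomorphism onto a relatively open subset of S. *)
Definition local_param (r k : nat) S (U : set 'rV[R]_k)
    (phi : 'rV[R]_k -> 'rV[R]_d) :=
  [/\ open U,
      Ckv r U phi,
      {in U &, injective phi},
      forall u, U u -> row_free (jacobian phi u) &
      forall U', open U' -> U' `<=` U ->
        exists2 W, open W & phi @` U' = S `&` W].

Definition submanifold (r k : nat) S :=
  forall p, S p -> exists (U : set 'rV[R]_k) (phi : 'rV[R]_k -> 'rV[R]_d),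
    local_param r S U phi /\ (phi @` U) p.

Definition tangent S p : set 'rV[R]_d :=
  [set v | exists gamma : R -> 'rV[R]_d,
     [/\ gamma 0 = p, \forall t \near (0 : R), S (gamma t) &
         is_derive (0 : R) 1 gamma v]].

Definition normal S p : set 'rV[R]_d :=
  [set n | forall v, tangent S p v -> inner n v = 0].

(* w = II(p)[u, v], computed with some local C^1 tangent extension X of v *)
Definition second_fundamental_form S p u v (w : 'rV[R]_d) :=
  exists (W : set 'rV[R]_d) (X : 'rV[R]_d -> 'rV[R]_d),
    [/\ [/\ open W, W p & Ckv 1 W X],
        forall q, W q -> S q -> tangent S q (X q),
        X p = v,
        normal S p w &
        tangent S p ('D_u X p - w)].

Definition second_fundamental_form_bounded S (C : R) :=
  forall p u w, S p -> tangent S p u -> enorm u = 1 ->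
    second_fundamental_form S p u u w -> enorm w <= C.

(* components of the induced metric in the coordinates of phi, Christoffel
   symbols Gamma^l_ij of its Levi-Civita connection, and components R^l_cij of
   its curvature: R(e_i, e_j) e_c = \sum_l R^l_cij e_l *)
Definition metric k (phi : 'rV[R]_k -> 'rV[R]_d) (u : 'rV[R]_k) : 'M[R]_k :=
  jacobian phi u *m (jacobian phi u)^T.

Definition christoffel k (phi : 'rV[R]_k -> 'rV[R]_d) (l i j : 'I_k)
    (u : 'rV[R]_k) : R :=
  let G i j := fun u => metric phi u i j in
  2^-1 * \sum_a invmx (metric phi u) l a *
    (partial i (G a j) u + partial j (G a i) u - partial a (G i j) u).

Definition riemann k (phi : 'rV[R]_k -> 'rV[R]_d) (l c i j : 'I_k)
    (u : 'rV[R]_k) : R :=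
  let Gam := christoffel phi in
  partial i (Gam l j c) u - partial j (Gam l i c) u +
  \sum_a (Gam l i a u * Gam a j c u - Gam l j a u * Gam a i c u).

Definition sectional_curvature k (phi : 'rV[R]_k -> 'rV[R]_d)
    (u a b : 'rV[R]_k) : R :=
  let G := metric phi u in
  let g x y := inner (x *m G) y in
  (\sum_i \sum_j \sum_c \sum_l \sum_n
     a 0 i * b 0 j * b 0 c * a 0 n * riemann phi l c i j u * G l n) /
  (g a a * g b b - g a b ^+ 2).

(* Classical curvature needs a C^2 metric, i.e. C^3 parametrizations *)
Definition sectional_curvature_bounded (k : nat) S (C0 : R) :=
  forall (U : set 'rV[R]_k) (phi : 'rV[R]_k -> 'rV[R]_d),
    local_param 3 S U phi -> forall u a b, U u -> row_free (col_mx a b) ->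
      `|sectional_curvature phi u a b| <= C0.

(* geodesics of the induced metric: the acceleration is normal to S *)
Definition geodesic S (gamma : R -> 'rV[R]_d) :=
  forall t : R,
    [/\ S (gamma t), derivable gamma t 1, derivable (derive1 gamma) t 1,
        {for t, continuous (derive1n 2 gamma)} &
        normal S (gamma t) (derive1n 2 gamma t)].

(* q = exp_p(v) *)
Definition riem_exp S p v (q : 'rV[R]_d) :=
  exists gamma, [/\ geodesic S gamma, gamma 0 = p, derive1 gamma 0 = v &
                    gamma 1 = q].

(* exp_p is a diffeomorphism from the open ball of radius r of T_p S (with
   coordinates in an orthonormal basis, the rows of E) onto an open subset
   of S. *)
Definition exp_diffeo (k : nat) S p (r : R) :=
  exists (E : 'M[R]_(k, d)) (phi : 'rV[R]_k -> 'rV[R]_d),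
    [/\ E *m E^T = 1%:M,
        forall i, tangent S p (row i E),
        local_param 1 S (eball r) phi &
        forall u, eball r u -> riem_exp S p (u *m E) (phi u)].

Definition injectivity_radius (k : nat) S p : \bar R :=
  ereal_sup [set r%:E | r in [set r : R | 0 < r /\ exp_diffeo k S p r]].

Definition C1_curve_in S (gamma : R -> 'rV[R]_d) :=
  forall t, t \in `[0, 1] ->
    [/\ S (gamma t), derivable gamma t 1 & {for t, continuous (derive1 gamma)}].

Definition curve_length (gamma : R -> 'rV[R]_d) : \bar R :=
  (\int[lebesgue_measure]_(t in `[0%R, 1%R]) (enorm (derive1 gamma t))%:E)%E.

(* some piecewise C^1 curve in S from p to q has length l *)
Inductive joined S : 'rV[R]_d -> 'rV[R]_d -> \bar R -> Prop :=
| joined_refl p : S p -> joined S p p 0%E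
| joined_step gamma q l : C1_curve_in S gamma -> joined S (gamma 1) q l ->
    joined S (gamma 0) q (curve_length gamma + l)%E.

Definition geodesic_dist S p q : \bar R := ereal_inf [set l | joined S p q l].

Definition geodesic_ball S p (r : R) : set 'rV[R]_d :=
  [set q | S q /\ (geodesic_dist S p q < r%:E)%E].

End Submanifold.

Section Measures.
Context {R : realType}.

(* R^n with its Borel sigma-algebra *)
Definition borelV (n : nat) := g_sigma_algebraType (@open 'rV[R]_n).

Definition box n (ab : 'rV[R]_n * 'rV[R]_n) : set 'rV[R]_n :=
  [set x | forall i, ab.1 0 i <= x 0 i <= ab.2 0 i].

Definition box_volume n (ab : 'rV[R]_n * 'rV[R]_n) : R :=
  \prod_i Num.max (ab.2 0 i - ab.1 0 i) 0.

(* n-dimensional Lebesgue outer measure; it is only evaluated on Borel sets,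
   where it is Lebesgue measure. *)
Definition lebesgue_rV n (A : set (borelV n)) : \bar R :=
  ereal_inf [set (\sum_(0 <= i <oo) (box_volume (c i))%:E)%E
            | c in [set c : nat -> 'rV[R]_n * 'rV[R]_n |
                     A `<=` \bigcup_i box (c i)]].

Definition is_coupling n (mu nu : set (borelV n) -> \bar R)
    (P : probability (borelV n * borelV n)%type R) :=
  forall A, measurable A ->
    P (A `*` setT) = mu A /\ P (setT `*` A) = nu A.

Definition W1 n (mu nu : set (borelV n) -> \bar R) : \bar R :=
  ereal_inf [set (\int[P]_z (enorm (z.1 - z.2 : 'rV[R]_n))%:E)%E
            | P in [set P | is_coupling mu nu P]].

(* V is the Riemannian volume measure of S, seen as a Borel measure on R^d
   carried by S: in local coordinates its density is sqrt(det(metric)), which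
   determines it uniquely. *)
Definition riemannian_volume d (k : nat) (S : set 'rV[R]_d)
    (V : {measure set (borelV d) -> \bar R}) :=
  V (~` S) = 0%E /\
  forall (U : set 'rV[R]_k) (phi : 'rV[R]_k -> 'rV[R]_d), local_param 1 S U phi ->
    forall B : set (borelV d), measurable B ->
      V (B `&` phi @` U) =
      (\int[@lebesgue_rV k]_(u in (U `&` phi @^-1` B : set (borelV k)))
         (Num.sqrt (\det (metric phi u)))%:E)%E.

Definition gibbs d (h : 'rV[R]_d -> R) (lambda : R) (A : set (borelV d)) :
    \bar R :=
  let dens x := (expR (- h x / lambda))%:E in
  ((fine (\int[@lebesgue_rV d]_x dens x))^-1%:E *
     \int[@lebesgue_rV d]_(x in A) dens x)%E.

(* det(H)^(-1/2) with H the Hessian of h at a compressed to the normal space,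
   written in an orthonormal basis of that space (the rows of B) *)
Definition normal_weight d (k : nat) (S : set 'rV[R]_d) (h : 'rV[R]_d -> R)
    (a : 'rV[R]_d) : R :=
  xget 0 [set w | exists B : 'M[R]_(d - k, d),
    [/\ B *m B^T = 1%:M, forall i, normal S a (row i B) &
        w = (Num.sqrt (\det (B *m hess h a *m B^T)))^-1]].

Definition limit_density d (k : nat) (S : set 'rV[R]_d) (h : 'rV[R]_d -> R)
    (V : {measure set (borelV d) -> \bar R}) (a : 'rV[R]_d) : R :=
  normal_weight k S h a /
    fine (\int[V]_(x in (S : set (borelV d))) (normal_weight k S h x)%:E)%E.

Definition limit_measure d (k : nat) (S : set 'rV[R]_d) (h : 'rV[R]_d -> R)
    (V : {measure set (borelV d) -> \bar R}) (A : set (borelV d)) : \bar R :=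
  (\int[V]_(a in A `&` S) (limit_density k S h V a)%:E)%E.

Definition sqg_objective d (f g : 'rV[R]_d -> R) (lambda delta beta : R) :
    \bar R :=
  (beta%:E + (delta^-1)%:E *
     \int[gibbs g lambda]_x (Num.max (f x - beta) 0)%:E)%E.

Definition Gamma (x : R) : R :=
  \int[lebesgue_measure]_(t in `]0, +oo[) (t `^ (x - 1) * expR (- t)).

(* volume of the Euclidean unit ball of R^k *)
Definition ball_volume (k : nat) : R :=
  pi `^ (k%:R / 2) / Gamma (k%:R / 2 + 1).

End Measures.

(* Main.v *)
Require Import Defs.
From HB Require Import structures.
From mathcomp Require Import all_boot all_order all_algebra.
From mathcomp Require Import all_classical all_reals all_analysis.
From mathcomp Require Import measurable_realfun lra.
Import numFieldNormedType.Exports.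
Import Order.TTheory GRing.Theory Num.Theory.

Set Implicit Arguments.
Unset Strict Implicit.
Unset Printing Implicit Defensive.

Local Open Scope classical_set_scope.
Local Open Scope ring_scope.

(** Fix [theta], write [f] for [f theta], [S] for the solution set and [nu] for
    the limiting measure, and let [p] maximize [f] on [S]. The superquantile loss
    is the minimum over [beta] of the Rockafellar-Uryasev objective
    [beta + E (f - beta)_+ / delta], which reacts to two things only.

    Replacing the Gibbs measure by [nu]: the excess [(y - beta)_+] is 1-Lipschitz
    in [y] and [f] is [Lf1]-Lipschitz, so along a coupling of cost [w] the
    objective moves by at most [Lf1 / delta * w], uniformly in [beta]
    ([excess_perturbation]). Couplings of cost arbitrarily close to the
    Wasserstein distance then account for the term in [sqrt lambda].

    The upper tail of [f] under [nu]: if [f] is at most [f p] almost everywhere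
    and at least [f p - s] on a set of mass at least [delta], the objective at
    [beta = f p] equals [f p], and at every [beta] it is at least [f p - s]
    ([superquantile_objective_le], [superquantile_objective_ge]). The set is
    found around [p]: a geodesic ball of radius [t] lies in the Euclidean ball of
    radius [t] ([enorm_lt_geodesic_ball]), so [f >= f p - Lf1 * t] on it, and its
    mass is at least [kappa * cL * ball_volume k * t ^+ k]. The radius at which
    this lower bound equals [delta] is
    [delta `^ (1/k) / (kappa * cL * ball_volume k) `^ (1/k)], and the smallness
    condition on [delta] ensures that volume growth applies at this radius.

    Two technical points carry weight. Comparing the volume of a geodesic ball
    with the mass of a superlevel set requires the ball to be Borel, which holds
    because it is relatively open in the closed set [S]
    ([geodesic_ball_relatively_open]). And the Gibbs and limiting measures enter
    as bare set functions: finiteness of their Wasserstein distance yields a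
    coupling, which exhibits both as marginals of a probability measure. In
    particular [S] is not empty, since [nu] vanishes off [S] and has mass 1. *)

(** * The Euclidean norm *)

Section EuclideanNorm.
Context {R : realType} {n : nat}.
Implicit Types (x y z : 'rV[R]_n) (a : R).

Lemma innerC x y : inner x y = inner y x.
Proof. by apply: eq_bigr => i _; rewrite mulrC. Qed.

Lemma innerDl x y z : inner (x + y) z = inner x z + inner y z.
Proof. by rewrite -big_split; apply: eq_bigr => i _; rewrite mxE mulrDl. Qed.

Lemma innerZl a x z : inner (a *: x) z = a * inner x z.
Proof. by rewrite mulr_sumr; apply: eq_bigr => i _; rewrite mxE mulrA. Qed.

Lemma innerBl x y z : inner (x - y) z = inner x z - inner y z.
Proof. by rewrite -scaleN1r innerDl innerZl mulN1r. Qed.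

Lemma innerZr a x z : inner x (a *: z) = a * inner x z.
Proof. by rewrite innerC innerZl innerC. Qed.

Lemma innerBr x y z : inner z (x - y) = inner z x - inner z y.
Proof. by rewrite innerC innerBl !(innerC _ z). Qed.

Lemma inner_ge0 x : 0 <= inner x x.
Proof. by apply: sumr_ge0 => i _; rewrite -expr2 sqr_ge0. Qed.

Lemma enorm_ge0 x : 0 <= enorm x.
Proof. exact: sqrtr_ge0. Qed.

Lemma sqr_enorm x : enorm x ^+ 2 = inner x x.
Proof. by rewrite sqr_sqrtr// inner_ge0. Qed.

Lemma coord_le_enorm x i : `|x 0 i| <= enorm x.
Proof.
rewrite -sqrtr_sqr ler_wsqrtr// /inner (bigD1 i)//= -expr2 lerDl.
by apply: sumr_ge0 => j _; rewrite -expr2 sqr_ge0.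
Qed.

Lemma enorm_eq0 x : enorm x = 0 -> x = 0.
Proof.
move=> x0; apply/rowP => i; apply/eqP; rewrite mxE -normr_le0 -x0.
exact: coord_le_enorm.
Qed.

Lemma enorm0 : enorm (0 : 'rV[R]_n) = 0.
Proof.
by rewrite /enorm /inner big1 ?sqrtr0// => i _; rewrite mxE mul0r.
Qed.

Lemma enormN x : enorm (- x) = enorm x.
Proof. by congr Num.sqrt; apply: eq_bigr => i _; rewrite !mxE mulrNN. Qed.

(** Positivity of the squared norm of [enorm y *: x - enorm x *: y]. *)
Lemma Cauchy_Schwarz x y : inner x y <= enorm x * enorm y.
Proof.
have [/enorm_eq0 ->|x0] := eqVneq (enorm x) 0.
  by rewrite enorm0 mul0r /inner big1// => i _; rewrite mxE mul0r.
have [/enorm_eq0 ->|y0] := eqVneq (enorm y) 0.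
  by rewrite enorm0 mulr0 /inner big1// => i _; rewrite mxE mulr0.
have xy0 : 0 < enorm x * enorm y.
  by rewrite mulr_gt0// lt_neqAle enorm_ge0 eq_sym ?x0 ?y0.
rewrite -subr_ge0 -(pmulr_rge0 _ xy0).
have := inner_ge0 (enorm y *: x - enorm x *: y).
rewrite innerBl !innerBr !innerZl !innerZr -!sqr_enorm (innerC y x).
nra.
Qed.

Lemma enormD x y : enorm (x + y) <= enorm x + enorm y.
Proof.
rewrite -ler_sqr ?nnegrE ?addr_ge0 ?enorm_ge0// sqrrD !sqr_enorm innerDl.
rewrite !(innerC _ (x + y)) !innerDl (innerC y x).
have := Cauchy_Schwarz x y; lra.
Qed.

(** [inner x x] is a sum of products [x_i * x_i], each at most
    [enorm x * `|x_i|]; then divide by [enorm x]. *)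
Lemma enorm_le_sum x : enorm x <= \sum_i `|x 0 i|.
Proof.
have [->|x0] := eqVneq (enorm x) 0; first exact: sumr_ge0.
have {}x0 : 0 < enorm x by rewrite lt_neqAle eq_sym x0 enorm_ge0.
rewrite -(ler_pM2l x0) -expr2 sqr_enorm mulr_sumr.
apply: ler_sum => i _; apply: le_trans (ler_norm _) _.
by rewrite normrM ler_wpM2r// coord_le_enorm.
Qed.

Lemma enorm_continuous : continuous (@enorm R n).
Proof.
have inner_continuous : continuous (fun x : 'rV[R]_n => inner x x).
  apply: (continuous_big (@add_continuous R)) => i _ x.
  by apply: continuousM; exact: coord_continuous.
move=> x; have := continuous_comp (inner_continuous x) (@sqrt_continuous R _).
exact.
Qed.

End EuclideanNorm.

(** * Curves are at least as long as their chords *)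

Section CurveLength.
Context {R : realType} {d : nat}.
Implicit Types (S : set 'rV[R]_d) (gamma : R -> 'rV[R]_d) (t : R).

Lemma derive_inner gamma t (e : 'rV[R]_d) : derivable gamma t 1 ->
  is_derive t 1 (fun s => inner (gamma s) e : R) (inner (derive1 gamma t) e).
Proof.
move=> dg; have dgi i : derivable (fun s => gamma s 0 i) t 1.
  by move/derivable_mxP : dg; exact.
have -> : (fun s => inner (gamma s) e : R) =
    \sum_(i < d) (e 0 i *: (fun s => gamma s 0 i)).
  apply/funext => s; rewrite fct_sumE; apply: eq_bigr => i _.
  by rewrite [RHS]mulrC.
apply: DeriveDef; first by apply: derivable_sum => i; exact: derivableZ.
rewrite derive_sum => [|i]; last exact: derivableZ.
apply: eq_bigr => i _; rewrite deriveZ// derive1E derive_mx// mxE.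
by rewrite mulrC.
Qed.

Lemma speed_continuous S gamma : C1_curve_in S gamma ->
  {within `[0, 1], continuous (fun t => enorm (derive1 gamma t))}.
Proof.
move=> Sgamma; apply: continuous_in_subspaceT => t /set_mem /= t01.
have [_ _ c] := Sgamma t t01.
have := continuous_comp c (@enorm_continuous R d _).
exact.
Qed.

(** The component of the velocity along the chord integrates to the squared chord
    length, and is at most the speed times the chord length. *)
Lemma curve_length_ge_chord S gamma : C1_curve_in S gamma ->
  ((enorm (gamma 1 - gamma 0))%:E <= curve_length gamma)%E.
Proof.
move=> Sgamma; set e := gamma 1 - gamma 0.
have [->|e0] := eqVneq (enorm e) 0.
  by rewrite /curve_length integral_ge0// => t _; rewrite lee_fin enorm_ge0.
have {}e0 : 0 < enorm e by rewrite lt_neqAle eq_sym e0 enorm_ge0.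
have dh t : t \in `[0, 1] ->
    is_derive t 1 (fun s => inner (gamma s) e : R) (inner (derive1 gamma t) e).
  by move=> /Sgamma[_ + _]; exact: derive_inner.
have ch t : t \in `[0, 1] -> {for t, continuous (fun s => inner (gamma s) e : R)}.
  move=> t01; apply: differentiable_continuous; apply/derivable1_diffP.
  by have [] := dh t t01.
have cf : {within `[0, 1], continuous (fun t => inner (derive1 gamma t) e : R)}.
  apply: continuous_in_subspaceT => t /set_mem /= t01.
  have [_ _ c] := Sgamma t t01.
  have inner_continuous : continuous (fun x : 'rV[R]_d => inner x e).
    apply: (continuous_big (@add_continuous R)) => i _ x.
    by apply: continuousM; [exact: coord_continuous|exact: cst_continuous].
  have := continuous_comp c (inner_continuous _).
  exact.
have : (\int[lebesgue_measure]_(t in `[0%R, 1%R]) (inner (derive1 gamma t) e)%:E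
        = (inner (gamma 1) e)%:E - (inner (gamma 0) e)%:E)%E.
  apply: (@continuous_FTC2 R (fun t => inner (derive1 gamma t) e)
    (fun t => inner (gamma t) e)) => //.
  - split=> [t t01||].
    + by have [] := dh t (subset_itv_oo_cc t01).
    + by apply: cvg_at_right_filter; apply: ch; rewrite in_itv/= lexx ler01.
    + by apply: cvg_at_left_filter; apply: ch; rewrite in_itv/= lexx ler01.
  - by move=> t /subset_itv_oo_cc/dh[_ <-]; rewrite derive1E.
rewrite -EFinB -innerBl -sqr_enorm => chordE.
have int_speed := continuous_compact_integrable (@segment_compact R 0 1)
  (speed_continuous Sgamma).
have : ((enorm e ^+ 2)%:E <= (enorm e)%:E * curve_length gamma)%E.
  rewrite -chordE -integralZl//.
  apply: le_integral => //.
  - exact: continuous_compact_integrable (@segment_compact R 0 1) cf.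
  - exact: integrableZl.
  - by move=> t _; rewrite -EFinM lee_fin mulrC Cauchy_Schwarz.
by rewrite expr2 EFinM lee_pmul2l.
Qed.

Lemma joined_ge_enorm S p q l : joined S p q l -> ((enorm (p - q))%:E <= l)%E.
Proof.
elim=> {p q l} [p _|gamma q l Sgamma _ IH]; first by rewrite subrr enorm0.
apply: le_trans (leeD (curve_length_ge_chord Sgamma) IH).
rewrite -EFinD lee_fin -enormN opprB -(subrKA (gamma 1)).
by rewrite (le_trans (enormD _ _))// addrC lerD// -enormN opprB.
Qed.

Lemma enorm_lt_geodesic_ball S p q r :
  geodesic_ball S p r q -> enorm (p - q) < r.
Proof.
move=> [_ /ereal_inf_lt[l pql lr]]; rewrite -lte_fin.
exact: le_lt_trans (joined_ge_enorm pql) lr.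
Qed.

(** [joined] extends a path at its starting point; a new piece at the end point is
    what moving the target of a path requires. *)
Lemma joined_rcons S p q l gamma : joined S p q l -> C1_curve_in S gamma ->
  gamma 0 = q -> joined S p (gamma 1) (l + curve_length gamma)%E.
Proof.
move=> pql Sgamma; elim: pql => {p q l} [p _ <-|eta q l Seta _ IH /IH].
  rewrite add0e -[X in joined _ _ _ X]adde0.
  apply: (joined_step Sgamma); apply: joined_refl.
  by have [] := Sgamma 1 _; first by rewrite in_itv/= ler01 lexx.
by rewrite -addeA; exact: joined_step.
Qed.

End CurveLength.

(** * Geodesic balls are relatively open *)

Section GeodesicBallOpen.
Context {R : realType} {d : nat}.
Implicit Types (S : set 'rV[R]_d).

Lemma Ck_C1 n r (U : set 'rV[R]_n) f : Ck r.+1 U f -> Ck 1 U f.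
Proof.
elim: r f => // r IH f [df dpf]; split=> // i x Ux.
by apply: differentiable_continuous; exact: (IH _ (dpf i)).1.
Qed.

Lemma submanifold_C1 r k S : submanifold r.+1 k S -> submanifold 1 k S.
Proof.
move=> mS p /mS[U [phi [[oU Cphi injphi freephi openphi] Up]]].
exists U, phi; split=> //; split=> // j; exact: Ck_C1 (Cphi j).
Qed.

Lemma cvg_rV T (F : set_system T) n (f : T -> 'rV[R]_n) (l : 'rV[R]_n) :
  Filter F ->
  (forall j, f x 0 j @[x --> F] --> l 0 j) -> f @ F --> l.
Proof.
move=> FF fl; apply/cvg_ballP => e e0; near=> x; split=> // i j.
rewrite ord1; move: j; near: x; apply: filter_forall => j.
by have /cvg_ballP := fl j; exact.
Unshelve. all: by end_near. Qed.

Section Segment.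
Context {k : nat}.
Variables (U : set 'rV[R]_k) (phi : 'rV[R]_k -> 'rV[R]_d) (u w : 'rV[R]_k).
Hypotheses (oU : open U) (Cphi : Ckv 1 U phi).

Let seg (t : R) : 'rV[R]_k := u + t *: w.

Let velocity (t : R) : 'rV[R]_d :=
  \row_j \sum_i w 0 i * partial i (fun x => phi x 0 j) (seg t).

(** Along a segment with direction [w], each coordinate has the very difference
    quotients that define its directional derivative along [w]. *)
Lemma is_derive_segment t : U (seg t) ->
  is_derive t 1 (fun s => phi (seg s)) (velocity t).
Proof.
move=> Ut.
have quotE j : (fun h : R => h^-1 *: (((fun s => phi (seg s) 0 j) \o shift t)
                   (h *: 1) - phi (seg t) 0 j)) =
    (fun h : R => h^-1 *: (((fun x => phi x 0 j) \o shift (seg t))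
                   (h *: w) - phi (seg t) 0 j)).
  apply/funext => h /=; congr (_ *: (phi _ 0 j - _)).
  by rewrite /seg /= [h *: 1]mulr1 scalerDl addrCA.
have dphi j : differentiable (fun x => phi x 0 j : R) (seg t).
  exact: (Cphi j).1.
have dseg : derivable (fun s => phi (seg s)) t 1.
  apply/derivable_mxP => i j; rewrite ord1 /derivable quotE.
  exact: diff_derivable.
apply: DeriveDef => //; rewrite derive_mx//; apply/rowP => j; rewrite !mxE.
rewrite /derive quotE -/(derive _ _ _) deriveE//.
rewrite {1}(row_sum_delta w) linear_sum; apply: eq_bigr => i _.
by rewrite linearZ /partial deriveE.
Qed.

Lemma segment_C1_curve S : (forall x, U x -> S (phi x)) ->
  (forall t, t \in `[0, 1] -> U (seg t)) ->
  C1_curve_in S (fun t => phi (seg t)).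
Proof.
move=> phiS segU t t01.
have Ut := segU t t01.
have [dt _] := is_derive_segment Ut.
split; [exact: phiS|exact: dt|].
have cseg : {for t, continuous seg}.
  apply: cvgD; first exact: cvg_cst.
  by apply: cvgZr_tmp.
have Unear : \forall s \near t, U (seg s) by apply: cseg; exact: open_nbhs_nbhs.
have velE s : U (seg s) -> derive1 (fun t => phi (seg t)) s = velocity s.
  by move=> /is_derive_segment[_ <-]; rewrite derive1E.
rewrite /prop_for /continuous_at velE//.
have : velocity s @[s --> t] --> velocity t.
  apply: cvg_rV => j; rewrite mxE; under eq_fun do rewrite mxE.
  apply: (cvg_big (@add_continuous R)) => i _.
  apply: cvgM; first exact: cvg_cst.
  have := continuous_comp cseg ((Cphi j).2 i _ Ut).
  exact.
apply: cvg_trans; apply: near_eq_cvg.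
by apply: filterS Unear => s /velE.
Qed.

Lemma segment_length_le S (M rho : R) : (forall x, U x -> S (phi x)) ->
  (forall t, t \in `[0, 1] -> U (seg t)) ->
  (forall t i j, t \in `[0, 1] ->
     `|partial i (fun x => phi x 0 j) (seg t)| <= M) ->
  (forall i, `|w 0 i| <= rho) ->
  (curve_length (fun t => phi (seg t)) <= (rho * M *+ k *+ d)%:E)%E.
Proof.
move=> phiS segU leM lerho.
have speed t : t \in `[0, 1] ->
    enorm (derive1 (fun t => phi (seg t)) t) <= rho * M *+ k *+ d.
  move=> t01; have [_] := is_derive_segment (segU t t01).
  rewrite derive1E => ->.
  apply: le_trans (enorm_le_sum _) _.
  rewrite -[X in _ *+ X](card_ord d) -sumr_const; apply: ler_sum => j _.
  rewrite mxE; apply: le_trans (ler_norm_sum _ _ _) _.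
  rewrite -[X in _ *+ X](card_ord k) -sumr_const; apply: ler_sum => i _.
  by rewrite normrM ler_pM// leM.
rewrite /curve_length.
apply: (@le_trans _ _ (\int[lebesgue_measure]_(t in `[0%R, 1%R])
    (rho * M *+ k *+ d)%:E)%E); last first.
  rewrite integral_cst//= lebesgue_measure_itv/= lte_fin ltr01.
  by rewrite -EFinB subr0 mule1.
have spc := speed_continuous (segment_C1_curve phiS segU).
apply: le_integral => //.
- exact: continuous_compact_integrable (@segment_compact R 0 1) spc.
- apply: continuous_compact_integrable (@segment_compact R 0 1) _.
  exact: continuous_subspaceT (@cst_continuous _ _ _).
- by move=> t /set_mem /speed; rewrite lee_fin.
Qed.

End Segment.

(** A path from [p] to a point [q] of the ball has length less than [r]. In a chart
    around [q], the images of straight segments issued from the parameter of [q]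
    reach a whole relative neighborhood of [q], and they use up less than the
    remaining length when the parameters stay in a small enough ball. *)
Lemma geodesic_ball_relatively_open k S p r : submanifold 1 k S ->
  exists2 O, open O & geodesic_ball S p r = S `&` O.
Proof.
move=> mS; pose O := [set W | open W /\ S `&` W `<=` geodesic_ball S p r].
exists (\bigcup_(W in O) W); first by apply: bigcup_open => W [].
apply/seteqP; split=> [q pq|q [Sq [W [_ WB] Wq]]]; last exact: WB.
have [Sq /ereal_inf_lt[l pql lr]] := pq; split=> //.
have [l' l'E] : exists l', l = l'%:E.
  have := le_trans _ (joined_ge_enorm pql); case: l {pql} lr => [l' _ _||].
  - by exists l'.
  - by rewrite ltNge leey.
  - by move=> _ /(_ 0%:E); rewrite lee_fin enorm_ge0 => /(_ isT).
rewrite {}l'E lte_fin in pql lr.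
have [U [phi [[oU Cphi _ _ openphi] [u0 Uu0 phiu0]]]] := mS q Sq.
have phiS x : U x -> S (phi x).
  have [W _ WE] := openphi U oU (@subset_refl _ _).
  by move=> Ux; have [] : (S `&` W) (phi x) by rewrite -WE; exists x.
pose D i j := partial i (fun x => phi x 0 j).
(* The margin 1 makes M a bound of the partial derivatives near u0, not just at
   u0; adding 1 to the denominator of rho makes the final inequality strict. *)
pose M : R := 1 + \sum_i \sum_j `|D i j u0|.
have M_ge0 : 0 <= M.
  by rewrite addr_ge0// sumr_ge0// => i _; rewrite sumr_ge0.
have near_u0 : \forall x \near u0, U x /\ forall i j, `|D i j x| <= M.
  near=> x; split; first by near: x; exact: open_nbhs_nbhs.
  near: x; apply: filter_forall => i; apply: filter_forall => j.
  have : {for u0, continuous (fun x => `|D i j x|)}.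
    have := continuous_comp ((Cphi j).2 i _ Uu0) (@norm_continuous _ R _).
    exact.
  move=> /cvgr_le; apply; apply: le_lt_trans (_ : _ <= \sum_i \sum_j `|D i j u0|) _.
    rewrite (bigD1 i)//= (bigD1 j)//= -addrA lerDl.
    by rewrite addr_ge0// sumr_ge0// => a _; rewrite sumr_ge0.
  by rewrite ltrDr.
have [rho0 /= rho0_gt0 ball_sub] := (nbhs_ballP _ _).1 near_u0.
pose rho := Num.min rho0 ((r - l') / (M *+ k *+ d + 1)).
have den_gt0 : 0 < M *+ k *+ d + 1 by rewrite ltr_wpDl// !mulrn_wge0.
have rho_gt0 : 0 < rho by rewrite lt_min rho0_gt0 divr_gt0// subr_gt0.
have rho_le : rho <= rho0 by rewrite ge_min lexx.
have [||W oW WE] := openphi (ball u0 rho).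
- exact: ball_open.
- by move=> x /(le_ball rho_le)/ball_sub[].
exists W; last first.
  have [] // : (S `&` W) q by rewrite -WE; exists u0 => //; exact: ballxx.
split=> // q'; rewrite -WE => -[u uball <-] {q'}.
have seg_ball t : t \in `[0, 1] -> ball u0 rho (u0 + t *: (u - u0)).
  rewrite in_itv/= => /andP[t0 t1]; split=> // a b; have [_ /(_ a b)] := uball.
  rewrite /ball/= !mxE opprD addNKr normrN normrM distrC (ger0_norm t0).
  by apply: le_lt_trans; rewrite ler_piMl.
have segU t : t \in `[0, 1] -> U (u0 + t *: (u - u0)).
  by move=> /seg_ball/(le_ball rho_le)/ball_sub[].
have segC1 := segment_C1_curve oU Cphi phiS segU.
have := joined_rcons pql segC1 _.
rewrite scale0r scale1r addr0 subrKC => /(_ phiu0) joined_pu.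
split; first by have [] := segC1 1 _; rewrite ?in_itv/= ?ler01 ?lexx// scale1r subrKC.
apply: le_lt_trans (ereal_inf_lbound joined_pu) _.
have len := @segment_length_le k U phi u0 (u - u0) oU Cphi S M rho phiS segU.
apply: (@le_lt_trans _ _ (l' + rho * M *+ k *+ d)%:E).
  rewrite EFinD leeD2l//; apply: len => [t i j|i].
    by move=> /seg_ball/(le_ball rho_le)/ball_sub[_]; exact.
  have [_ /(_ 0 i)] := uball; rewrite /ball/= !mxE distrC; exact: ltW.
rewrite lte_fin -ltrBrDl.
apply: (@lt_le_trans _ _ (rho * (M *+ k *+ d + 1))).
  by rewrite [rho * (_ + 1)]mulrDr mulr1 !mulrnAr ltrDl.
by rewrite -ler_pdivlMr// ge_min lexx orbT.
Unshelve. all: by end_near. Qed.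

End GeodesicBallOpen.

(** * The superquantile of a random variable *)

Section Superquantile.
Context d (T : measurableType d) (R : realType) (P : probability T R).
Implicit Types (X Y W : T -> R) (delta beta c : R).

(** The Rockafellar-Uryasev objective, whose minimum over [beta] is the mean of the
    upper tail of mass [delta] of [X]. *)
Definition superquantile_objective X delta beta : \bar R :=
  (beta%:E + (delta^-1)%:E * \int[P]_z (Num.max (X z - beta) 0)%:E)%E.

Lemma measurable_excess X beta : measurable_fun setT X ->
  measurable_fun setT (fun z => Num.max (X z - beta) 0).
Proof. by move=> mX; apply: measurable_maxr => //; exact: measurable_funB. Qed.

Lemma excess_ge0 X beta z : 0 <= Num.max (X z - beta) 0.
Proof. by rewrite le_max lexx orbT. Qed.

(** The objective is continuous in [beta], being Lipschitz. It is at least [beta],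
    and also at least an affine function of [beta] with the negative slope
    [1 - 1/delta]; so it exceeds its value at 0 outside a compact interval. *)
Lemma superquantile_attained X delta : 0 < delta < 1 ->
  P.-integrable setT (EFin \o X) ->
  exists m : R, is_min (range (superquantile_objective X delta)) m%:E.
Proof.
move=> /andP[delta_gt0 delta_lt1] iX.
have mX : measurable_fun setT X by apply/measurable_EFinP; exact: measurable_int iX.
have icst (a : R) : P.-integrable setT (EFin \o cst a).
  exact: finite_measure_integrable_cst.
have Ecst (a : R) : (\int[P]_z a)%R = a.
  rewrite Rintegral_cst// -[RHS]mulr1; congr (_ * _).
  exact: (congr1 fine (probability_setT P)).
have iXB beta : P.-integrable setT (EFin \o (fun z => X z - beta)).
  exact: (integrableB measurableT iX (icst beta)).
have iexc beta : P.-integrable setT (EFin \o (fun z => Num.max (X z - beta) 0)).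
  apply: le_integrable (iXB beta) => //.
    by apply/measurable_EFinP; exact: measurable_excess.
  move=> z _ /=; rewrite lee_fin (ger0_norm (excess_ge0 _ _ _)) ge_max.
  by rewrite ler_norm normr_ge0.
pose e beta := (\int[P]_z Num.max (X z - beta) 0)%R.
pose phi beta := beta + delta^-1 * e beta.
have objE beta : superquantile_objective X delta beta = (phi beta)%:E.
  by rewrite /phi EFinD EFinM fineK// integrable_fin_num//; exact: iexc.
have e_ge0 beta : 0 <= e beta by apply: Rintegral_ge0 => z _; exact: excess_ge0.
have e_ge beta : (\int[P]_z X z)%R - beta <= e beta.
  rewrite -[X in _ - X <= _](Ecst beta) -RintegralB//; last exact: icst.
  by apply: le_Rintegral => // z _; rewrite le_max lexx.
have e_lip beta beta' : e beta <= e beta' + `|beta' - beta|.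
  rewrite -[X in _ <= _ + X]Ecst -RintegralD//; last exact: icst.
  apply: le_Rintegral => //.
    exact: (integrableD measurableT (iexc beta') (icst _)).
  move=> z _; rewrite ge_max addr_ge0 ?excess_ge0// andbT -(subrKA beta').
  by rewrite lerD ?ler_norm// le_max lexx.
have phi_cont : continuous phi.
  have e_cont : continuous e.
    move=> b; apply/cvgrPdist_le => eps eps0; near=> b'.
    apply: (@le_trans _ _ `|b - b'|); last first.
      by near: b'; apply: cvgr_dist_le.
    have := e_lip b b'; have := e_lip b' b; rewrite distrC ler_norml.
    by rewrite (distrC b'); lra.
  move=> b; apply: cvgD => //; apply: cvgM; first exact: cvg_cst.
  exact: e_cont.
pose a := Num.min 0 (- (phi 0 - (\int[P]_z X z)%R / delta) / (delta^-1 - 1)).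
have slope_gt0 : 0 < delta^-1 - 1 by rewrite subr_gt0 invf_gt1.
have phi0_ge0 : 0 <= phi 0 by rewrite /phi add0r mulr_ge0// invr_ge0 ltW.
have a_le0 : a <= 0 by rewrite ge_min lexx.
have phi_left beta : beta < a -> phi 0 <= phi beta.
  rewrite lt_min => /andP[_]; rewrite ltr_pdivlMr// => betaa.
  have : delta^-1 * ((\int[P]_z X z)%R - beta) <= delta^-1 * e beta.
    by rewrite ler_wpM2l// invr_ge0 ltW.
  rewrite {2}/phi; lra.
have phi_right beta : phi 0 < beta -> phi 0 <= phi beta.
  move=> /ltW /le_trans; apply.
  by rewrite lerDl mulr_ge0// invr_ge0 ltW.
have [] := @EVT_min R phi a (phi 0).
- exact: le_trans phi0_ge0.
- exact: continuous_subspaceT.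
move=> b _ phib; exists (phi b); split; first by exists b.
move=> _ [beta _ <-]; rewrite objE lee_fin.
have phib0 : phi b <= phi 0 by apply: phib; rewrite in_itv/= a_le0.
have [/phi_left|betaa] := ltP beta a; first exact: le_trans.
have [/phi_right|betab] := ltP (phi 0) beta; first exact: le_trans.
by apply: phib; rewrite in_itv/= betaa.
Unshelve. all: by end_near. Qed.

Section Perturbation.
Variables (X Y W : T -> R) (L w c delta : R).
Hypotheses (mX : measurable_fun setT X) (mY : measurable_fun setT Y).
Hypotheses (mW : measurable_fun setT W) (W_ge0 : forall z, 0 <= W z).
Hypotheses (L_ge0 : 0 <= L) (Ww : (\int[P]_z (W z)%:E <= w%:E)%E).
Hypothesis delta_gt0 : 0 < delta.

(** [y |-> max (y - beta) 0] is nondecreasing and 1-Lipschitz. *)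
Let excess_perturbation (X1 X2 : T -> R) beta :
  measurable_fun setT X1 -> measurable_fun setT X2 ->
  (forall z, X1 z - X2 z <= L * W z) ->
  (\int[P]_z (Num.max (X1 z - beta) 0)%:E <=
   \int[P]_z (Num.max (X2 z - beta) 0)%:E + (L * w)%:E)%E.
Proof.
move=> mX1 mX2 X12.
have LW_ge0 z : 0 <= L * W z by rewrite mulr_ge0.
apply: (@le_trans _ _ (\int[P]_z (Num.max (X2 z - beta) 0)%:E +
                       \int[P]_z (L * W z)%:E)%E); last first.
  rewrite leeD2l//; under eq_integral do rewrite EFinM.
  rewrite ge0_integralZl//; last 2 first.
  - by apply/measurable_EFinP.
  - by move=> z _; rewrite lee_fin.
  by rewrite EFinM lee_wpmul2l.
rewrite -ge0_integralD//; last 4 first.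
- by move=> z _; rewrite lee_fin excess_ge0.
- by apply/measurable_EFinP; exact: measurable_excess.
- by move=> z _; rewrite lee_fin.
- by apply/measurable_EFinP; exact: measurable_funM.
apply: ge0_le_integral => //.
- by move=> z _; rewrite lee_fin excess_ge0.
- by apply/measurable_EFinP; exact: measurable_excess.
- apply/measurable_EFinP; apply: measurable_funD; first exact: measurable_excess.
  exact: measurable_funM.
- move=> z _; rewrite lee_fin ge_max addr_ge0 ?excess_ge0// andbT.
  rewrite -(subrKA (X2 z)) addrC lerD// le_max lexx//.
Qed.

(** At [beta = c] the variable [Y] has no excess. *)
Lemma superquantile_objective_le :
  (forall z, X z - Y z <= L * W z) -> {ae P, forall z, Y z <= c} ->
  (superquantile_objective X delta c <= (c + L / delta * w)%:E)%E.
Proof.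
move=> XY Yc; rewrite /superquantile_objective EFinD leeD2l//.
rewrite mulrAC [_ / delta]mulrC EFinM; apply: lee_wpmul2l.
  by rewrite lee_fin invr_ge0 ltW.
apply: le_trans (excess_perturbation c mX mY XY) _.
rewrite (_ : (\int[P]_z _ = 0)%E) ?add0e//.
rewrite -[RHS](@integral0 _ _ _ P setT); apply: (ae_eq_integral (cst 0%E)) => //.
  by apply/measurable_EFinP; exact: measurable_excess.
apply: filterS Yc => z Yzc _; congr EFin; apply/max_idPr.
by rewrite subr_le0.
Qed.

(** The mean excess of [Y] over [beta] is at least [(c - beta) * delta]: for
    [beta < c] because [Y] reaches [c] with probability at least [delta], otherwise
    by sign. Dividing by [delta] cancels [beta]. *)
Lemma superquantile_objective_ge beta :
  (forall z, Y z - X z <= L * W z) -> (delta%:E <= P [set z | (c <= Y z)%R])%E ->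
  ((c - L / delta * w)%:E <= superquantile_objective X delta beta)%E.
Proof.
move=> YX Yc; have := excess_perturbation beta mY mX YX.
have mA : measurable [set z | c <= Y z].
  rewrite -[X in measurable X]setTI.
  have -> : [set z | c <= Y z] = Y @^-1` `[c, +oo[.
    by apply/seteqP; split=> z /=; rewrite in_itv/= andbT.
  exact: mY.
have excess_ge : (((c - beta) * delta)%:E <=
    \int[P]_z (Num.max (Y z - beta) 0)%:E)%E.
  have [cb|cb] := leP c beta.
    apply: le_trans (_ : 0 <= _)%E.
      by rewrite lee_fin mulr_le0_ge0 ?subr_le0// ltW.
    by apply: integral_ge0 => z _; rewrite lee_fin excess_ge0.
  apply: (@le_trans _ _ (\int[P]_(z in [set z | (c <= Y z)%R]) (c - beta)%:E)%E).
    rewrite integral_cst// EFinM lee_wpmul2l// lee_fin subr_ge0 ltW//.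
  apply: (@le_trans _ _ (\int[P]_(z in [set z | (c <= Y z)%R])
                           (Num.max (Y z - beta) 0)%:E)%E).
    apply: ge0_le_integral => //.
    - by move=> z _; rewrite lee_fin subr_ge0 ltW.
    - apply/measurable_EFinP; apply: measurable_funTS.
      exact: measurable_excess.
    - by move=> z /= cY; rewrite lee_fin le_max lerB.
  apply: ge0_subset_integral => //.
  - by apply/measurable_EFinP; exact: measurable_excess.
  - by move=> z _; rewrite lee_fin excess_ge0.
move=> /(le_trans excess_ge); rewrite /superquantile_objective.
have : (0 <= \int[P]_z (Num.max (X z - beta) 0)%:E)%E.
  by apply: integral_ge0 => z _; rewrite lee_fin excess_ge0.
case: (\int[P]_z _)%E => [x|_|//] _; last first.
  by rewrite mulry gtr0_sg ?invr_gt0// mul1e addey// leey.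
rewrite -EFinM -!EFinD !lee_fin => x_ge.
have : delta^-1 * ((c - beta) * delta) <= delta^-1 * (x + L * w).
  by rewrite ler_wpM2l// invr_ge0 ltW.
rewrite mulrCA mulVf ?gt_eqF// mulr1; lra.
Qed.

End Perturbation.
End Superquantile.

(** * Couplings and the limiting measure *)

Section Coupling.
Context {R : realType} {n : nat}.
Import HBNNSimple.
Local Notation Bn := (@borelV R n).
Implicit Types (f : 'rV[R]_n -> R) (mu nu : set Bn -> \bar R).

Lemma open_borelV (O : set 'rV[R]_n) : open O -> measurable (O : set Bn).
Proof. exact: sub_sigma_algebra. Qed.

Lemma closed_borelV (A : set 'rV[R]_n) :
  closed A -> measurable (A : set Bn).
Proof.
move=> cA; rewrite -[A]setCK; apply: measurableC; apply: open_borelV.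
exact: closed_openC.
Qed.

Lemma continuous_borelV f :
  continuous f -> measurable_fun setT (f : Bn -> R).
Proof.
move=> /continuousP cf; apply: (measurability _ (RGenOpens.measurableE R)).
move=> _ [_ [a [b ->] <-]]; rewrite setTI; apply: open_borelV.
exact/cf/interval_open.
Qed.

Lemma continuous_borelV_fst f :
  continuous f -> measurable_fun setT (fun z : Bn * Bn => f z.1).
Proof.
by move=> cf; exact: measurableT_comp (continuous_borelV cf) measurable_fst.
Qed.

Lemma continuous_borelV_snd f :
  continuous f -> measurable_fun setT (fun z : Bn * Bn => f z.2).
Proof.
by move=> cf; exact: measurableT_comp (continuous_borelV cf) measurable_snd.
Qed.

Lemma measurable_enormB : measurable_fun setT
  (fun z : Bn * Bn => enorm (z.1 - z.2 : 'rV[R]_n)).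
Proof.
have c i : continuous (fun x : 'rV[R]_n => x 0 i) := @coord_continuous _ _ _ 0 i.
apply: (measurableT_comp (continuous_measurable_fun (@sqrt_continuous R))).
apply: measurable_sum => i; under eq_fun do rewrite !mxE.
have mdiff : measurable_fun setT (fun z : Bn * Bn =>
    (z.1 : 'rV[R]_n) 0 i - (z.2 : 'rV[R]_n) 0 i).
  apply: measurable_funB; first exact: (continuous_borelV_fst (c i)).
  exact: (continuous_borelV_snd (c i)).
exact: measurable_funM.
Qed.

Lemma lipschitz_enorm_continuous f L :
  (forall x y, `|f x - f y| <= L * enorm (x - y)) -> continuous f.
Proof.
move=> f_lip.
have cL (x : 'rV[R]_n) : continuous (fun y : 'rV[R]_n => L * enorm (x - y)).
  move=> y; apply: (@cvgM _ _ (nbhs y)); first exact: cvg_cst.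
  have := @continuous_comp _ _ _ (fun y : 'rV[R]_n => x - y) (@enorm R n) y.
  apply; last exact: enorm_continuous.
  by apply: (@cvgB _ _ _ (nbhs y)); [exact: cvg_cst|exact: cvg_id].
move=> x; suff : f y @[y --> x] --> f x by [].
apply/(@cvgrPdist_le _ _ _ (nbhs x)) => e e_gt0.
have := @cvgr_le _ _ (nbhs x) _ _ _ (cL x x).
rewrite subrr enorm0 mulr0 => /(_ _ _ e_gt0).
by apply: filterS => y; exact: le_trans.
Qed.

(** Only the values on measurable sets enter an integral. It applies to set
    functions not known to be measures, such as those joined by a coupling. *)
Lemma eq_integral_measurable d (T : measurableType d)
    (mu nu : set T -> \bar R) (h : T -> \bar R) :
  (forall A, measurable A -> mu A = nu A) ->
  (\int[mu]_x h x = \int[nu]_x h x)%E.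
Proof.
move=> mu_nu; have sE (s : {nnsfun T >-> R}) : sintegral mu s = sintegral nu s.
  by apply: eq_fsbigr => r _; rewrite mu_nu.
rewrite /integral; congr (ereal_sup _ - ereal_sup _)%E;
  by apply: eq_imagel => s _; exact: sE.
Qed.

Lemma coupling_integral_fst mu nu P (h : Bn -> R) : is_coupling mu nu P ->
  measurable_fun setT h -> (forall x, 0 <= h x) ->
  (\int[mu]_x (h x)%:E = \int[P]_z (h z.1)%:E)%E.
Proof.
move=> muP mh h_ge0.
rewrite (@eq_integral_measurable _ _ _ (pushforward P fst)) => [|A mA].
  rewrite (ge0_integral_pushforward (@measurable_fst _ _ Bn Bn))//.
    exact/measurable_EFinP.
  by move=> x _; rewrite lee_fin.
by have [<- _] := muP A mA; congr (P _); apply/seteqP; split=> z // [].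
Qed.

(** The integral of a nonnegative function is the supremum over the simple functions
    below it, so it is monotone even for integrands that are not measurable, as
    may be the case of [limit_density]. *)
Lemma ge0_le_integral_restrict d (T : measurableType d)
    (mu : {measure set T -> \bar R}) (A B : set T) (h1 h2 : T -> \bar R) :
  A `<=` B -> (forall x, A x -> 0 <= h1 x <= h2 x)%E ->
  (forall x, B x -> 0 <= h2 x)%E ->
  (\int[mu]_(x in A) h1 x <= \int[mu]_(x in B) h2 x)%E.
Proof.
move=> AB h12 h2_ge0.
have h1_ge0 x : A x -> (0 <= h1 x)%E by move=> /h12/andP[].
rewrite !ge0_integralE//; apply: ereal_sup_le => _ [s sh1 <-].
exists s => // x; apply: le_trans (sh1 x) _.
rewrite /patch; case: ifPn => [/set_mem Ax|_].
  by rewrite (mem_set (AB x Ax)); have /andP[] := h12 x Ax.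
by case: ifPn => // /set_mem /h2_ge0.
Qed.

Lemma limit_measure_ge k S h (V : {measure set Bn -> \bar R}) kappa
    (A B : set Bn) :
  0 <= kappa -> (forall a, S a -> kappa <= limit_density k S h V a) ->
  measurable B -> B `<=` A `&` S ->
  (kappa%:E * V B <= limit_measure k S h V A)%E.
Proof.
move=> kappa_ge0 density_ge mB BAS; rewrite -integral_cst//.
apply: ge0_le_integral_restrict => // x.
- by move=> /BAS[_ /density_ge]; rewrite !lee_fin kappa_ge0.
- by move=> [_ /density_ge]; rewrite lee_fin; exact: le_trans.
Qed.

Lemma limit_measure_setC k S h (V : {measure set Bn -> \bar R}) :
  limit_measure k S h V (~` S) = 0%E.
Proof. by rewrite /limit_measure setICl integral_set0. Qed.

Lemma W1_coupling mu nu w : (W1 mu nu < w)%E ->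
  exists2 P, is_coupling mu nu P &
    (\int[P]_z (enorm (z.1 - z.2 : 'rV[R]_n))%:E <= w)%E.
Proof. by move=> /ereal_inf_lt[_ [P muP <-] Pw]; exists P => //; exact: ltW. Qed.

End Coupling.

Section TransportBounds.
Context {R : realType} {n : nat}.
Local Notation Bn := (@borelV R n).
Variables (mu nu : set Bn -> \bar R).
Variables (P : probability (Bn * Bn)%type R) (w : R).
Hypothesis muP : is_coupling mu nu P.
Hypothesis Pw : (\int[P]_z (enorm (z.1 - z.2 : 'rV[R]_n))%:E <= w%:E)%E.
Variables (S : set 'rV[R]_n) (f : 'rV[R]_n -> R) (L : R).
Hypothesis S_compact : compact S.
Hypothesis nuS : nu (~` S) = 0%E.
Hypothesis f_lip : forall x y, `|f x - f y| <= L * enorm (x - y).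

(** The second marginal is carried by [S]. *)
Lemma coupling_ae (Q : Bn * Bn -> Prop) :
  (forall z, S z.2 -> Q z) -> {ae P, forall z, Q z}.
Proof.
move=> SQ.
have mS : measurable (~` S : set Bn).
  have S_closed : closed S := @compact_closed _ _ (@norm_hausdorff _ _) S_compact.
  exact: measurableC (closed_borelV S_closed).
exists (setT `*` ~` S); split=> //.
- exact: measurableX.
- by have [_ ->] := muP mS.
- by move=> z /= nQz; split=> // /SQ.
Qed.

(** [f] is bounded at [z.2], almost surely in the compact set [S], and the Lipschitz
    bound passes to [z.1] at the price of the integrable transport distance. *)
Lemma integrable_fst : S !=set0 -> P.-integrable setT (fun z => (f z.1)%:E).
Proof.
move=> S0; have cf := lipschitz_enorm_continuous f_lip.
have cnf : {within S, continuous (fun x => `|f x|)}.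
  apply: continuous_subspaceT => x.
  have := continuous_comp (cf x) (@norm_continuous _ R _).
  exact.
have [a _ fa] := EVT_max_rV S0 S_compact cnf.
have iW : P.-integrable setT (fun z => (enorm (z.1 - z.2 : 'rV[R]_n))%:E).
  apply/integrableP; split; first by apply/measurable_EFinP; exact: measurable_enormB.
  under eq_integral do rewrite gee0_abs ?lee_fin ?enorm_ge0//.
  exact: le_lt_trans Pw (ltry _).
have iaW : P.-integrable setT
    (fun z => (`|f a| + L * enorm (z.1 - z.2 : 'rV[R]_n))%:E).
  have := integrableD measurableT
    (finite_measure_integrable_cst P `|f a| measurableT)
    (integrableZl measurableT L iW).
  exact.
have mf := continuous_borelV_fst cf.
apply/integrableP; split; first exact/measurable_EFinP.
have /integrableP[maW] := iaW; apply: le_lt_trans.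
apply: ae_ge0_le_integral => //.
- by apply: measurableT_comp => //; exact/measurable_EFinP.
- exact: measurableT_comp.
apply: coupling_ae => z Sz _; rewrite !abse_EFin lee_fin.
apply: le_trans (ler_norm _); rewrite addrC -(subrK (f z.2) (f z.1)).
by rewrite (le_trans (ler_normD _ _))// lerD// fa// inE.
Qed.

End TransportBounds.

(** * The bound on the superquantile loss *)

Section Assembly.
Context {R : realType}.

(** A global minimum is a local one, so [K] contains [argmin h], which is closed as
    an intersection of sublevel sets. *)
Lemma argmin_compact d (h : 'rV[R]_d -> R) K : continuous h -> compact K ->
  locmin h `<=` K -> compact (argmin h).
Proof.
move=> ch cK hK; apply: subclosed_compact cK _; last first.
  by move=> x hx; apply: hK; exact: (@nearW _ (nbhs x) _ _ hx).
have -> : argmin h = \bigcap_(y in setT) (h @^-1` [set z | z <= h y]).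
  by apply/seteqP; split=> x hx y => [_|]; exact: hx.
apply: closed_bigI => y _; apply: preimage_closed; last exact: closed_le.
by move=> x _; exact: ch.
Qed.

Lemma uniform_PLcirc_compact m d (Theta : set 'rV[R]_m)
    (g : 'rV[R]_m -> 'rV[R]_d -> R) theta :
  uniform_PLcirc Theta g -> Theta theta -> compact (solset g theta).
Proof.
move=> [mu _ gPL] /gPL[_ [N [[[dg _] _ _] _ [K cK gK]]]].
by apply: argmin_compact cK gK => x; apply: differentiable_continuous; exact: dg.
Qed.

Lemma sqg_objectiveE d (f g : 'rV[R]_d -> R) lambda delta nu P :
  is_coupling (gibbs g lambda) nu P -> continuous f ->
  sqg_objective f g lambda delta =
  superquantile_objective P (fun z => f z.1) delta.
Proof.
move=> muP cf; apply/funext => beta; congr (_ + _ * _)%E.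
apply: (coupling_integral_fst (h := fun x => Num.max (f x - beta) 0) muP).
  by apply: measurable_excess; exact: continuous_borelV.
by move=> x; exact: excess_ge0.
Qed.

(** The geodesic ball around [p] lies in the superlevel set, because geodesic balls
    lie in Euclidean ones; being Borel, it transmits its volume. *)
Lemma limit_measure_superlevel d k (S : set 'rV[R]_d) h
    (V : {measure set (borelV d) -> \bar R}) (f : 'rV[R]_d -> R) L p r kappa v :
  submanifold 1 k S -> closed S -> continuous f ->
  (forall x y, `|f x - f y| <= L * enorm (x - y)) -> 0 <= L -> 0 <= kappa ->
  (forall a, S a -> kappa <= limit_density k S h V a) ->
  (v%:E <= V (geodesic_ball S p r))%E ->
  ((kappa * v)%:E <= limit_measure k S h V [set x | (f p - L * r <= f x)%R])%E.
Proof.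
move=> mS cS cf f_lip L_ge0 kappa_ge0 density_ge volume_ge.
apply: le_trans (_ : (kappa%:E * V (geodesic_ball S p r) <= _)%E); last first.
  apply: limit_measure_ge => //.
    have [W oW ->] := geodesic_ball_relatively_open p r mS.
    by apply: measurableI; [exact: closed_borelV|exact: open_borelV].
  move=> q pq; split; last by case: pq.
  rewrite /= lerBlDr -lerBlDl; apply: le_trans (ler_norm _) _.
  apply: le_trans (f_lip _ _) _; rewrite ler_wpM2l// ltW//.
  exact: enorm_lt_geodesic_ball pq.
by rewrite EFinM lee_wpmul2l.
Qed.

Lemma root_ratioXn (a b : R) k : (0 < k)%N -> 0 <= a -> 0 <= b ->
  (a `^ k%:R^-1 / b `^ k%:R^-1) ^+ k = a / b.
Proof.
move=> k_gt0 a_ge0 b_ge0.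
have rootK (x : R) : 0 <= x -> (x `^ k%:R^-1) ^+ k = x.
  move=> x_ge0; rewrite -powR_mulrn ?powR_ge0// -powRrM mulVf ?powRr1//.
  by rewrite pnatr_eq0 -lt0n.
by rewrite expr_div_n !rootK.
Qed.

End Assembly.

Theorem theorem4p5 (R : realType) (m d k : nat)
    (hm : (1 <= m)%N) (hd : (2 <= d)%N) (hk : (1 <= k)%N)
    (Theta : set 'rV[R]_m)
    (Theta0 : Theta !=set0) (Theta_compact : compact Theta)
    (Theta_convex : convex_set (Theta : set (convex_lmodType 'rV[R]_m)))
    (f g : 'rV[R]_m -> 'rV[R]_d -> R)
    (* uniform PL condition and regularity conditions *)
    (g_PL : uniform_PLcirc Theta g)
    (Lf1 : R) (f_reg : upper_regular Theta f Lf1)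
    (g_reg : lower_regular Theta g)
    (* k is the common dimension of the solution sets *)
    (S_dim : forall theta, Theta theta -> submanifold 2 k (solset g theta))
    (* curvature bound *)
    (S_curv : exists2 C : R, 0 < C & forall theta, Theta theta ->
       second_fundamental_form_bounded (solset g theta) C)
    (* Riemannian volume measures *)
    (vol : 'rV[R]_m -> {measure set (borelV d) -> \bar R})
    (volP : forall theta, Theta theta ->
       riemannian_volume k (solset g theta) (vol theta))
    (K0 lambda0 : R) (lambda0_gt0 : 0 < lambda0)
    (gibbs_W1 : forall theta (lambda : R), Theta theta -> 0 < lambda <= lambda0 ->
       (W1 (gibbs (g theta) lambda)
           (limit_measure k (solset g theta) (g theta) (vol theta))
        <= (K0 * Num.sqrt lambda)%:E)%E)
    (* geometric constants *)
    (C0 : R) (C0_gt0 : 0 < C0)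
    (C0P : forall theta, Theta theta ->
       sectional_curvature_bounded k (solset g theta) C0)
    (r0 : R) (r0_gt0 : 0 < r0)
    (r0P : forall theta p, Theta theta -> solset g theta p ->
       (r0%:E <= injectivity_radius k (solset g theta) p)%E)
    (kappa : R) (kappa_gt0 : 0 < kappa)
    (kappaP : forall theta a, Theta theta -> solset g theta a ->
       kappa <= limit_density k (solset g theta) (g theta) (vol theta) a
             <= kappa^-1)
    (cL c1 : R) (cL_gt0 : 0 < cL) (c1_gt0 : 0 < c1)
    (cLP : forall theta p (r : R), Theta theta -> solset g theta p ->
       0 < r < Num.min r0 (c1 / Num.sqrt (2 * C0)) ->
       ((cL * ball_volume k * r ^+ k)%:E <=
          vol theta (geodesic_ball (solset g theta) p r))%E) :
  forall theta (delta lambda : R), Theta theta ->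
    0 < delta < 1 ->
    delta < cL * ball_volume k * kappa *
              (4^-1 * Num.min (c1 / Num.sqrt (2 * C0)) r0) ^+ k ->
    0 < lambda <= lambda0 ->
    (* the maximum and the minimum are attained, at finite values *)
    exists Fmax FSQG : R,
      [/\ is_max (f theta @` solset g theta) Fmax,
          is_min (range (sqg_objective (f theta) (g theta) lambda delta))
                 FSQG%:E &
          `|Fmax - FSQG| <=
            4 * Lf1 * delta `^ (k%:R^-1) /
              (kappa * cL * ball_volume k) `^ (k%:R^-1)
            + Lf1 / delta * K0 * Num.sqrt lambda].
Proof.
move=> theta delta lambda thetaT /andP[delta_gt0 delta_lt1] delta_small lambdaP.
set S := solset g theta.
move: (ball_volume k) cLP delta_small => Ck cLP delta_small.
have [_ f_lip' _] := f_reg.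
have f_lip x y : `|f theta x - f theta y| <= Lf1 * enorm (x - y).
  apply: le_trans (f_lip' _ _ _ _ thetaT thetaT) _.
  rewrite opp_row_mx add_row_mx subrr /enorm /inner big_split_ord/=.
  rewrite big1 ?add0r => [|i _]; last by rewrite row_mxEl mxE mul0r.
  by under eq_bigr do rewrite row_mxEr.
have L_ge0 : 0 <= Lf1.
  (* Any nonzero vector forces the sign of a Lipschitz constant. *)
  pose e : 'rV[R]_d := const_mx 1.
  have e_gt0 : 0 < enorm e.
    apply: lt_le_trans (coord_le_enorm e (Ordinal (ltnW hd))).
    by rewrite mxE normr1.
  have := le_trans (normr_ge0 _) (f_lip e 0).
  by rewrite subr0 pmulr_lge0.
have cf := lipschitz_enorm_continuous f_lip.
have S_compact : compact S := uniform_PLcirc_compact g_PL thetaT.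
have S_closed : closed S := @compact_closed _ _ (@norm_hausdorff _ _) S_compact.
set nu := limit_measure k S (g theta) (vol theta).
have coupling eps : 0 < eps -> exists2 P,
    is_coupling (gibbs (g theta) lambda) nu P &
    (\int[P]_z (enorm (z.1 - z.2 : 'rV[R]_d))%:E <=
       (K0 * Num.sqrt lambda + eps)%:E)%E.
  move=> eps_gt0; apply: W1_coupling.
  by apply: le_lt_trans (gibbs_W1 _ _ thetaT lambdaP) _; rewrite lte_fin ltrDl.
have nuSC : nu (~` S) = 0%E := limit_measure_setC k S (g theta) (vol theta).
have [P1 P1c P1w] := coupling 1 ltr01.
have S0 : S !=set0.
  apply/set0P/eqP => SE; have [_] := P1c (~` S) (measurableC (closed_borelV S_closed)).
  rewrite nuSC SE setC0 setXTT => P10.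
  have : P1 setT = 1%E := probability_setT P1.
  by rewrite P10 => /eqP; rewrite eqe eq_sym oner_eq0.
have [p /set_mem Sp p_max] := EVT_max_rV S0 S_compact (continuous_subspaceT cf).
have iX := integrable_fst P1c P1w S_compact nuSC f_lip S0.
have [v vP] := superquantile_attained (andb_true_intro (conj delta_gt0 delta_lt1)) iX.
rewrite -(sqg_objectiveE _ P1c cf) in vP.
exists (f theta p), v; split=> //.
  split; first by exists p.
  by move=> _ [x Sx <-]; apply: p_max; rewrite inE.
(* The radius at which the lower bound for the mass of a ball equals delta. *)
set t := delta `^ k%:R^-1 / (kappa * cL * Ck) `^ k%:R^-1.
set M := Num.min _ _ in delta_small.
have M_gt0 : 0 < M.
  by rewrite lt_min r0_gt0 divr_gt0// sqrtr_gt0 mulr_gt0.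
have a_gt0 : 0 < kappa * cL * Ck.
  have : 0 < cL * Ck * kappa * (4^-1 * M) ^+ k := lt_trans delta_gt0 delta_small.
  rewrite pmulr_lgt0; last by rewrite exprn_gt0// mulr_gt0.
  by rewrite [X in 0 < X -> _]mulrC mulrA.
have tk : t ^+ k = delta / (kappa * cL * Ck).
  by apply: root_ratioXn => //; exact: ltW.
have t_gt0 : 0 < t by rewrite divr_gt0// powR_gt0.
have t_small : t < 4^-1 * M.
  rewrite -(ltr_pXn2r hk) ?nnegrE ?(ltW t_gt0) ?mulr_ge0 ?(ltW M_gt0)//.
  rewrite tk ltr_pdivrMr// mulrC; apply: lt_le_trans delta_small _.
  by rewrite [_ * kappa]mulrC !mulrA.
have volume_ge : ((cL * Ck * t ^+ k)%:E <= vol theta (geodesic_ball S p t))%E.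
  apply: cLP => //; rewrite t_gt0/= minC; apply: lt_le_trans t_small _.
  by rewrite ler_piMl ?(ltW M_gt0)// invf_le1// ler1n.
have mS : submanifold 1 k S by apply: (@submanifold_C1 R d 1); exact: S_dim.
have delta_mass : (delta%:E <=
    nu [set x | (f theta p - Lf1 * t <= f theta x)%R])%E.
  have <- : kappa * (cL * Ck * t ^+ k) = delta.
    by rewrite tk !mulrA mulrAC divff ?mul1r// gt_eqF.
  apply: limit_measure_superlevel => //; first exact: ltW.
  by move=> a /(kappaP _ _ thetaT)/andP[].
have superlevel_meas : measurable
    ([set x | f theta p - Lf1 * t <= f theta x] : set (borelV d)).
  apply: (@closed_borelV _ _ (f theta @^-1` [set y | _ <= y])).
  by apply: preimage_closed; [move=> x _; exact: cf|exact: closed_ge].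
(* The infimum defining the Wasserstein distance need not be attained: a coupling
   of cost eps above the bound is used, with eps sent to 0. *)
apply/ler_addgt0Pr => eta eta_gt0.
have Ld_ge0 : 0 <= Lf1 / delta by rewrite divr_ge0// ltW.
pose eps := eta / (Lf1 / delta + 1).
have eps_gt0 : 0 < eps by rewrite divr_gt0// ltr_wpDl.
have Leps : Lf1 / delta * eps <= eta.
  by rewrite mulrA ler_pdivrMr ?ltr_wpDl// mulrDr mulr1 mulrC lerDl ltW.
have [P Pc Pw] := coupling eps eps_gt0.
rewrite (sqg_objectiveE _ Pc cf) in vP; have [[beta _ betaE] v_le] := vP.
have mX := continuous_borelV_fst cf.
have mY := continuous_borelV_snd cf.
have XY (z : borelV d * borelV d) :
    f theta z.1 - f theta z.2 <= Lf1 * enorm (z.1 - z.2 : 'rV[R]_d).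
  exact: le_trans (ler_norm _) (f_lip _ _).
have YX (z : borelV d * borelV d) :
    f theta z.2 - f theta z.1 <= Lf1 * enorm (z.1 - z.2 : 'rV[R]_d).
  by apply: le_trans (ler_norm _) _; rewrite distrC f_lip.
have W_ge0 (z : borelV d * borelV d) : 0 <= enorm (z.1 - z.2 : 'rV[R]_d).
  exact: enorm_ge0.
have mW := @measurable_enormB R d.
have upper : v <= f theta p + Lf1 / delta * (K0 * Num.sqrt lambda + eps).
  rewrite -lee_fin; apply: le_trans (v_le _ _) _; first by exists (f theta p).
  apply: (superquantile_objective_le mX mY mW W_ge0 L_ge0 Pw delta_gt0 XY).
  apply: (coupling_ae Pc S_compact nuSC) => z Sz.
  by apply: p_max; rewrite inE.
have lower :
    f theta p - Lf1 * t - Lf1 / delta * (K0 * Num.sqrt lambda + eps) <= v.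
  rewrite -lee_fin -betaE.
  apply: (superquantile_objective_ge mX mY mW W_ge0 L_ge0 Pw delta_gt0) => //.
  have [_ PA] := Pc _ superlevel_meas.
  by rewrite -PA setTX in delta_mass.
have Lt_ge0 : 0 <= Lf1 * t by rewrite mulr_ge0// ltW.
rewrite -[4 * Lf1 * _ / _]mulrA -/t; move: Leps upper lower Lt_ge0.
rewrite ler_norml mulrDr !mulrA; lra.
Qed.
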